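(* Let $G$ be an abelian group with identity $e$, $R$ a $G$-graded $gr$-Noetherian ring, $M$ a graded $R$-module, $N=\oplus_{h\in G}N_h$ a graded submodule of $M$ and $g\in G$. If $N_g$ is a $g$-$G2$-absorbing submodule of the $R_e$-module $M_g$ and $m_g\in M_g\setminus N_g$, then either $Gr((N_g:_{R_e}m_g))$ is an $e$-prime ideal of $R_e$, or there exist $r_e\in R_e\setminus Gr((N_g:_{R_e}m_g))$ and $n\in\mathbb{Z}^+$ such that $Gr((N_g:_{R_e}r_e^nm_g))$ is an $e$-prime ideal of $R_e$.
   Context: All rings are commutative with identity and all modules are unitary. $G$ is an abelian multiplicative group with identity $e$. A $G$-graded ring is $R=\oplus_{g\in G}R_g$ with $R_gR_h\subseteq R_{gh}$; $R_e$ is a subring containing $1$. $R$ is $gr$-Noetherian if it satisfies the ascending chain condition on graded ideals. A graded $R$-module is $M=\oplus_{g\in G}M_g$ with $R_gM_h\subseteq M_{gh}$; each $M_g$ is an $R_e$-module. A submodule $N$ of $M$ is graded if $N=\oplus_g N_g$ with $N_g=N\cap M_g$. $(N_g:_{R_e}X)=\{r\in R_e: rX\subseteq N_g\}$ for an element or subset $X$ of $M_g$. $N_g$ is a $g$-$G2$-absorbing submodule of $M_g$ if $N_g\neq M_g$ and whenever $r,s\in R_e$, $m\in M_g$ with $rsm\in N_g$, then $r^{k_1}\in(N_g:_{R_e}m)$ for some $k_1\in\mathbb{Z}^+$, or $s^{k_2}\in(N_g:_{R_e}m)$ for some $k_2\in\mathbb{Z}^+$, or $rs\in(N_g:_{R_e}M_g)$.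 For an ideal $A$ of $R_e$, $Gr(A)=\{x\in R_e: x^n\in A\text{ for some }n\geq 1\}$. An $e$-prime ideal of $R_e$ is a proper ideal $P$ of $R_e$ such that $r,s\in R_e$, $rs\in P$ implies $r\in P$ or $s\in P$. *)

(* Defs.v *)
From HB Require Import structures.
From mathcomp Require Import all_boot all_algebra.
From mathcomp Require Import classical_sets.

Set Implicit Arguments.
Unset Strict Implicit.
Unset Printing Implicit Defensive.

Import GRing.Theory.
Local Open Scope classical_set_scope.
Local Open Scope ring_scope.

Definition subgroup_of (V : zmodType) (A B : set V) : Prop :=
  [/\ A `<=` B, A 0 & forall x y, A x -> A y -> A (x - y)].

(* Internal direct sum: B = \oplus_i A_i, where finite sets of indices are
   duplicate-free sequences. *)
Definition is_direct_sum (V : zmodType) (I : eqType)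
    (B : set V) (A : I -> set V) : Prop :=
  [/\ forall i, subgroup_of (A i) B,
      B = [set x | exists s : seq I, exists f : I -> V,
             [/\ uniq s, forall i, A i (f i) & x = \sum_(i <- s) f i]]
    & forall (s : seq I) (f : I -> V), uniq s -> (forall i, A i (f i)) ->
        \sum_(i <- s) f i = 0 -> {in s, forall i, f i = 0}].

(* K is an ideal of the ring carried by the subset S of R. *)
Definition ideal_of (R : comPzRingType) (S K : set R) : Prop :=
  subgroup_of K S /\ forall r x, S r -> K x -> K (r * x).

(* N is an S-submodule of the S-module carried by the subset X of M. *)
Definition submodule_of (R : comPzRingType) (M : lmodType R)
    (S : set R) (X N : set M) : Prop :=
  subgroup_of N X /\ forall r x, S r -> N x -> N (r *: x).

Definition graded_ring (G : groupType) (R : comPzRingType)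
    (Rg : G -> set R) : Prop :=
  is_direct_sum setT Rg /\
  forall g h r s, Rg g r -> Rg h s -> Rg (g * h)%g (r * s).

Definition graded_ideal (G : groupType) (R : comPzRingType)
    (Rg : G -> set R) (K : set R) : Prop :=
  ideal_of setT K /\ is_direct_sum K (fun g => K `&` Rg g).

Definition gr_noetherian (G : groupType) (R : comPzRingType)
    (Rg : G -> set R) : Prop :=
  forall K : nat -> set R,
    (forall n, graded_ideal Rg (K n)) -> (forall n, K n `<=` K n.+1) ->
    exists n, forall m, (n <= m)%N -> K m = K n.

Definition graded_module (G : groupType) (R : comPzRingType) (M : lmodType R)
    (Rg : G -> set R) (Mg : G -> set M) : Prop :=
  is_direct_sum setT Mg /\
  forall g h r m, Rg g r -> Mg h m -> Mg (g * h)%g (r *: m).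

Definition graded_submodule (G : groupType) (R : comPzRingType)
    (M : lmodType R) (Mg : G -> set M) (N : set M) : Prop :=
  submodule_of setT setT N /\ is_direct_sum N (fun g => N `&` Mg g).

(* The residual (N :_S X). *)
Definition residual (R : comPzRingType) (M : lmodType R)
    (S : set R) (N X : set M) : set R :=
  [set r | S r /\ forall x, X x -> N (r *: x)].

(* The radical of A in the ring carried by the subset S of R. *)
Definition radical (R : comPzRingType) (S A : set R) : set R :=
  [set x | S x /\ exists n, (0 < n)%N /\ A (x ^+ n)].

Definition prime_ideal_of (R : comPzRingType) (S P : set R) : Prop :=
  [/\ ideal_of S P, P <> S
    & forall r s, S r -> S s -> P (r * s) -> P r \/ P s].

Definition G2_absorbing (R : comPzRingType) (M : lmodType R)
    (S : set R) (X N : set M) : Prop :=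
  [/\ submodule_of S X N, N <> X
    & forall r s m, S r -> S s -> X m -> N ((r * s) *: m) ->
        [\/ exists k, (0 < k)%N /\ residual S N [set m] (r ^+ k),
            exists k, (0 < k)%N /\ residual S N [set m] (s ^+ k)
          | residual S N X (r * s)]].

(* Main.v *)
Require Import Defs.
From mathcomp Require Import all_boot all_algebra.
From mathcomp Require Import boolp classical_sets.

(** Write [I = (N_g : m_g)] and let [rad] be the radical in [R_e].  The ring
    [R_e] is Noetherian, so the ideals [(rad I : r)] with [r] in [R_e \ rad I]
    have a maximal member; it is prime by the classical argument for maximal
    annihilators.  The chain [(I : r^n)] stabilizes at some [n], and then
    [rad (I : r^n) = (rad I : r)].  As [(I : r^n) = (N_g : r^n m_g)], this is
    the second alternative.

    [R_e] is Noetherian because an ideal [K] of [R_e] is the contraction of the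
    graded ideal of all [x] such that [(s x)_e] lies in [K] for every [s]. *)

Set Implicit Arguments.
Unset Strict Implicit.
Unset Printing Implicit Defensive.

Import GRing.Theory.
Local Open Scope classical_set_scope.
Local Open Scope ring_scope.

(** * Components of elements in an internal direct sum *)

(** [c x i] is the component of [x] at [i]. The last clause encodes uniqueness: components can be
    read off any finite decomposition, with value 0 outside its index list. *)
Definition component_map (V : zmodType) (I : eqType) (A : I -> set V)
    (c : V -> I -> V) : Prop :=
  [/\ forall x i, A i (c x i),
      forall x, exists2 s, uniq s & x = \sum_(i <- s) c x i
    & forall s f, uniq s -> (forall i, A i (f i)) ->
        forall i, c (\sum_(i <- s) f i) i = if i \in s then f i else 0].

Lemma sum_restrict (V : zmodType) (I : eqType) (s t : seq I) (f : I -> V) :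
  uniq s -> uniq t -> {subset s <= t} ->
  \sum_(i <- t) (if i \in s then f i else 0) = \sum_(i <- s) f i.
Proof.
move=> us ut st; rewrite -big_mkcond -big_filter; apply: perm_big.
apply: uniq_perm => //; first exact: filter_uniq.
by move=> i; rewrite mem_filter; case: (boolP (i \in s)) => //= /st.
Qed.

(** Choice fixes one decomposition of each element. Any other one is compared with it on the union
    of the index lists, both padded by 0: the differences sum to 0, so each of them vanishes. *)
Lemma component_map_exists (V : zmodType) (I : eqType) (A : I -> set V) :
  is_direct_sum setT A -> exists c, component_map A c.
Proof.
case=> subA genA freeA.
have A0 i : A i 0 by case: (subA i).
have AB i x y : A i x -> A i y -> A i (x - y) by case: (subA i) => _ _; apply.
have dec x : exists p : seq I * (I -> V),
    [/\ uniq p.1, forall i, A i (p.2 i) & x = \sum_(i <- p.1) p.2 i].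
  have: [set: V] x by [].
  by rewrite genA => -[s [f [us Af xE]]]; exists (s, f).
case: (choice dec) => p pP.
pose c x i := if i \in (p x).1 then (p x).2 i else 0.
exists c; split=> [x i|x|s f us Af i].
- by rewrite /c; case: ifP => // _; case: (pP x).
- case: (pP x) => ux _ xE; exists (p x).1 => //.
  by rewrite [LHS]xE; apply: eq_big_seq => i ix; rewrite /c ix.
set x := \sum_(i <- s) f i.
have [ux Ax xE] := pP x.
pose f' j := if j \in s then f j else 0.
pose t := undup ((p x).1 ++ s).
have sub0 : \sum_(j <- t) (c x j - f' j) = 0.
  rewrite sumrB /c /f' !sum_restrict ?undup_uniq //.
  - by rewrite -xE subrr.
  - by move=> j js; rewrite mem_undup mem_cat js orbT.
  - by move=> j js; rewrite mem_undup mem_cat js.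
have Acf j : A j (c x j - f' j).
  by apply: AB; rewrite /c /f'; case: ifP.
have /= eq0 := freeA t _ (undup_uniq _) Acf sub0.
case: (boolP (i \in t)) => [/eq0/eqP|]; first by rewrite subr_eq0 => /eqP.
by rewrite mem_undup mem_cat negb_or /c => /andP[/negPf-> /negPf->].
Qed.

Lemma component_id (V : zmodType) (I : eqType) (A : I -> set V) c :
  (forall i, A i 0) -> component_map A c ->
  forall i x, A i x -> c x i = x.
Proof.
move=> A0 [_ _ uc] i x Aix.
(* A one-term decomposition; the family must lie in [A j] at every [j], hence the value 0 off
   [i]. *)
have := uc [:: i] (fun j => if j == i then x else 0) isT.
rewrite big_seq1 eqxx => /(_ _ i); rewrite inE eqxx; apply.
by move=> j; case: eqP => // ->.
Qed.

Lemma component_support (V : zmodType) (I : eqType) (A : I -> set V) c :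
  component_map A c ->
  forall x, exists s, [/\ uniq s, x = \sum_(i <- s) c x i
    & forall i, i \notin s -> c x i = 0].
Proof.
case=> Ac gc uc x; have [s us xE] := gc x; exists s; split=> // i /negPf nis.
by rewrite xE uc // nis.
Qed.

Lemma componentB (V : zmodType) (I : eqType) (A : I -> set V) c :
  is_direct_sum setT A -> component_map A c ->
  forall x y i, c (x - y) i = c x i - c y i.
Proof.
case=> subA _ _ cP x y i; have [Ac _ uc] := cP.
have [s [us xE cx0]] := component_support cP x.
have [t [ut yE cy0]] := component_support cP y.
(* Both elements are expanded over one common index list, so that their difference is again a single
   decomposition. *)
have ext z r : uniq r -> z = \sum_(j <- r) c z j ->
    (forall j, j \notin r -> c z j = 0) -> {subset r <= undup (s ++ t)} ->
    z = \sum_(j <- undup (s ++ t)) c z j.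
  move=> ur zE cz0 rst; rewrite {1}zE.
  rewrite -(sum_restrict _ ur (undup_uniq _) rst).
  by apply: eq_bigr => j _; case: ifPn => // /cz0.
have xE' : x = \sum_(j <- undup (s ++ t)) c x j.
  by apply: (ext _ s) => // j js; rewrite mem_undup mem_cat js.
have yE' : y = \sum_(j <- undup (s ++ t)) c y j.
  by apply: (ext _ t) => // j jt; rewrite mem_undup mem_cat jt orbT.
rewrite {1}xE' {1}yE' -sumrB uc ?undup_uniq //.
  case: ifPn => //; rewrite mem_undup mem_cat negb_or => /andP[/cx0-> /cy0->].
  by rewrite subrr.
by move=> j; case: (subA j) => _ _; apply.
Qed.

(** * Components in a graded ring *)

Lemma component_mulr (G : groupType) (R : comPzRingType) (Rg : G -> set R) c :
  graded_ring Rg -> component_map Rg c ->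
  forall s x h k, Rg h x -> c (s * x) k = c s (k * h^-1)%g * x.
Proof.
case=> _ mulR cP s x h k hx; have [Ac _ uc] := cP.
have [t [ut sE cs0]] := component_support cP s.
(* Multiplying by [x] of degree [h] translates the support of [s] by [h]; translation is injective,
   so the new index list is still duplicate-free. *)
have -> : s * x = \sum_(j <- [seq (i * h)%g | i <- t]) c s (j * h^-1)%g * x.
  rewrite big_map {1}sE mulr_suml; apply: eq_bigr => i _.
  by rewrite mulgK.
rewrite uc; first last.
- move=> j; rewrite -{1}[j](mulgVK h); exact: mulR.
- by rewrite map_inj_uniq //; apply: mulIg.
case: ifPn => // nk; rewrite cs0 ?mul0r //.
by apply: contra nk => kt; apply/mapP; exists (k * h^-1)%g; rewrite ?mulgVK.
Qed.

(** Comparing degree [h] components in [1 * x = x] shows that the identity component of 1 fixes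
    every homogeneous [x]. It therefore fixes 1, a sum of such elements, and so equals 1. *)
Lemma graded_ring1 (G : groupType) (R : comPzRingType) (Rg : G -> set R) :
  graded_ring Rg -> Rg 1%g 1.
Proof.
move=> gR; have [dR _] := gR; have [c cP] := component_map_exists dR.
have [Ac gc _] := cP.
have R0 i : Rg i 0 by case: dR => subR _ _; case: (subR i).
have c1 h x : Rg h x -> c 1 1%g * x = x.
  move=> hx; rewrite -{2}(component_id R0 cP hx).
  by rewrite -{2}[x]mul1r (component_mulr gR cP _ (h := h)) // mulgV.
have [s _ E] := gc 1.
suff -> : 1 = c 1 1%g by [].
rewrite -[RHS]mulr1 {3}E mulr_sumr {1}E; apply: eq_bigr => i _.
by rewrite (c1 i).
Qed.

(** * The ascending chain condition descends to the identity component *)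

Definition acc_ideals (R : comPzRingType) (S : set R) : Prop :=
  forall K : nat -> set R,
    (forall n, ideal_of S (K n)) -> (forall n, K n `<=` K n.+1) ->
    exists n, forall m, (n <= m)%N -> K m = K n.

(** When [K] is an ideal of [Rg 1] and [c] the component map, this is the largest graded ideal whose
    part of degree 1 lies in [K]. *)
Definition graded_hull (G : groupType) (R : comPzRingType) (c : R -> G -> R)
    (K : set R) : set R :=
  [set x | forall s, K (c (s * x) 1%g)].

Lemma graded_hull_ideal (G : groupType) (R : comPzRingType) (Rg : G -> set R)
    c K :
  graded_ring Rg -> component_map Rg c -> ideal_of (Rg 1%g) K ->
  graded_ideal Rg (graded_hull c K).
Proof.
move=> gR cP [[KR K0 KB] Kmul]; have [dR _] := gR; have [Ac gc uc] := cP.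
have [subR genR freeR] := dR.
have cB := componentB dR cP.
have H0 : graded_hull c K 0.
  by move=> s; rewrite mulr0 -(subrr 0) cB subrr.
have HB x y : graded_hull c K x -> graded_hull c K y ->
    graded_hull c K (x - y).
  by move=> Hx Hy s; rewrite mulrBr cB; apply: KB.
have HD x y : graded_hull c K x -> graded_hull c K y ->
    graded_hull c K (x + y).
  by move=> Hx Hy; rewrite -[y]opprK -[- y]sub0r; apply/HB/HB.
split; first by split=> // r x _ Hx s; rewrite mulrA.
split=> [i||s f us Hf].
- split=> [x []//|//|x y [Hx Rx] [Hy Ry]].
    by split=> //; case: (subR i).
  by split; [apply: HB|case: (subR i) => _ _; apply].
- apply/seteqP; split=> x.
    move=> Hx; have [s us xE] := gc x; exists s, (c x); split=> // i.
    split=> // r; rewrite (component_mulr gR cP _ (h := i)) // mul1g.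
    (* Testing [c x i] against [r] amounts to testing [x] against the component of [r] of degree
       [i^-1]: both products have identity component [c r i^-1 * c x i]. *)
    have := Hx (c r i^-1%g); rewrite mulrC.
    by rewrite (component_mulr gR cP _ (h := i^-1%g)) // mul1g invgK mulrC.
  case=> s [f [_ Hf ->]]; apply: (big_ind (graded_hull c K)) => // i _.
  by case: (Hf i).
- by apply: freeR => // i; case: (Hf i).
Qed.

(** For [x] of degree 1, the test with [s = 1] returns [x] itself, and a general [s] gives
    [c s 1 * x], a multiple of [x] by an element of [Rg 1]. *)
Lemma graded_hull_contract (G : groupType) (R : comPzRingType)
    (Rg : G -> set R) c K :
  graded_ring Rg -> component_map Rg c -> ideal_of (Rg 1%g) K ->
  graded_hull c K `&` Rg 1%g = K.
Proof.
move=> gR cP [[KR K0 KB] Kmul]; have [Ac _ _] := cP; have [dR _] := gR.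
have R0 i : Rg i 0 by case: dR => subR _ _; case: (subR i).
apply/seteqP; split=> [x [Hx Rx]|x Kx].
  by rewrite -(component_id R0 cP Rx) -[x]mul1r; apply: Hx.
split; last exact: KR.
move=> s; rewrite (component_mulr gR cP _ (h := 1%g)); last exact: KR.
by rewrite mulgV; apply: Kmul.
Qed.

Lemma gr_noetherian_acc (G : groupType) (R : comPzRingType) (Rg : G -> set R) :
  graded_ring Rg -> gr_noetherian Rg -> acc_ideals (Rg 1%g).
Proof.
move=> gR noeth K idK incK; have [dR _] := gR.
have [c cP] := component_map_exists dR.
have [||n nP] := noeth (fun n => graded_hull c (K n)).
- by move=> n; apply: graded_hull_ideal.
- by move=> n x Hx s; apply: incK.
exists n => m /nP HE.
by rewrite -(graded_hull_contract gR cP (idK m)) HE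
  (graded_hull_contract gR cP (idK n)).
Qed.

Lemma acc_ideals_maximal (R : comPzRingType) (S : set R) (T : Type)
    (D : set T) (C : T -> set R) :
  acc_ideals S -> (forall t, D t -> ideal_of S (C t)) -> D !=set0 ->
  exists2 t, D t & forall u, D u -> C t `<=` C u -> C u = C t.
Proof.
move=> acc idC [t0 Dt0]; apply: contrapT => nmax.
(* With [D t] placed under the existential, choice yields a total [F], which can be iterated from
   [t0] to give a strictly increasing chain. *)
have step t : exists u, D t -> [/\ D u, C t `<=` C u & C u <> C t].
  apply: contrapT => /forallNP nex; apply: nmax; exists t.
    by apply: contrapT => nDt; apply: (nex t) => /nDt.
  move=> u Du tu; apply: contrapT => nE; exact: (nex u).
have [F FP] := choice step.
pose a n := iter n F t0.
have Da n : D (a n) by elim: n => //= n /FP[].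
have [||n nP] := acc (fun n => C (a n)).
- by move=> n; apply: idC.
- by move=> n; case: (FP _ (Da n)).
by case: (FP _ (Da n)) => _ _; apply; apply: (nP n.+1).
Qed.

(** * Colon ideals and radicals in a subring *)

Definition subring_of (R : comPzRingType) (S : set R) : Prop :=
  [/\ S 1, forall x y, S x -> S y -> S (x - y)
    & forall x y, S x -> S y -> S (x * y)].

Definition colon (R : comPzRingType) (S I : set R) (r : R) : set R :=
  [set x | S x /\ I (x * r)].

Lemma subringX (R : comPzRingType) (S : set R) x n :
  subring_of S -> S x -> S (x ^+ n).
Proof.
by case=> S1 _ SM Sx; elim: n => [|n IH]; rewrite ?expr0 // exprS; apply: SM.
Qed.

Lemma ideal_colon (R : comPzRingType) (S I : set R) r :
  subring_of S -> ideal_of S I -> ideal_of S (colon S I r).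
Proof.
case=> S1 SB SM [[IS I0 IB] IM]; split; first split.
- by move=> x [].
- by split; [rewrite -(subrr 1); apply: SB|rewrite mul0r].
- by move=> x y [Sx Ix] [Sy Iy]; split; [apply: SB|rewrite mulrBl; apply: IB].
- by move=> s x Ss [Sx Ix]; split; [apply: SM|rewrite -mulrA; apply: IM].
Qed.

Lemma ideal_expr_leq (R : comPzRingType) (S I : set R) x k n :
  subring_of S -> ideal_of S I -> S x -> (k <= n)%N ->
  I (x ^+ k) -> I (x ^+ n).
Proof.
move=> sS [_ IM] Sx kn Ixk; rewrite -(subnK kn) exprD.
by apply: IM => //; apply: subringX.
Qed.

(** If [x ^+ k] and [y ^+ l] lie in [I], then every term of the expansion of [(x - y) ^+ (k + l)]
    contains [x] to a power at least [k] or [y] to a power at least [l]. *)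
Lemma ideal_radical (R : comPzRingType) (S I : set R) :
  subring_of S -> ideal_of S I -> ideal_of S (radical S I).
Proof.
move=> sS idI; have [S1 SB SM] := sS; have [[IS I0 IB] IM] := idI.
have S0 : S 0 by rewrite -(subrr 1); apply: SB.
have SN x : S x -> S (- x) by move=> Sx; rewrite -sub0r; apply: SB.
have ID x y : I x -> I y -> I (x + y).
  by move=> Ix Iy; rewrite -[y]opprK -[- y]sub0r; apply/IB/IB.
split; first split.
- by move=> x [].
- by split=> //; exists 1%N; rewrite expr1.
- move=> x y [Sx [k [k0 Ixk]]] [Sy [l [l0 Iyl]]]; split; first exact: SB.
  exists (k + l)%N; rewrite addn_gt0 k0; split=> //.
  rewrite exprBn; apply: (big_ind I) => // -[i /= ikl] _.
  (* The binomial coefficient becomes a ring element, which must be shown to lie in [S]. *)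
  rewrite -[_ *+ _]mulr_natr mulrC; apply: (IM).
    have: S 'C(k + l, i)%:R; last by [].
    elim: 'C(k + l, i) => [//|n Sn].
    by rewrite -addn1 natrD -[1%:R]opprK; apply/SB/SN.
  rewrite -mulrA; apply: (IM); first by apply: subringX => //; apply: SN.
  have [li|il] := leqP l i.
    apply: (IM); first exact: subringX.
    exact: (ideal_expr_leq sS idI Sy li).
  rewrite mulrC; apply: (IM); first exact: subringX.
  apply: (ideal_expr_leq sS idI Sx _ Ixk).
  by rewrite -addnBA ?leq_addr // ltnW.
- move=> r x Sr [Sx [k [k0 Ixk]]]; split; first exact: SM.
  exists k; split=> //; rewrite exprMn; apply: (IM) => //; exact: subringX.
Qed.

(** If [a * b * r] is in [J] but [b * r] is not, then [b * r] is an admissible multiplier whose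
    colon contains that of [r]. Maximality makes the two equal, and [a] lies in the colon of
    [b * r]. *)
Lemma maximal_colon_prime (R : comPzRingType) (S J : set R) r :
  subring_of S -> ideal_of S J -> (S `\` J) r ->
  (forall u, (S `\` J) u -> colon S J r `<=` colon S J u ->
     colon S J u = colon S J r) ->
  prime_ideal_of S (colon S J r).
Proof.
move=> sS idJ [Sr nJr] maxr; have [S1 SB SM] := sS; have [_ JM] := idJ.
split; first exact: ideal_colon.
  by move=> E; move: S1; rewrite -E => -[_]; rewrite mul1r.
move=> a b Sa Sb [_ Jabr]; case: (pselect (colon S J r b)); first by right.
move=> nb; left; rewrite -(maxr (b * r)).
- by split=> //; rewrite mulrA.
- by split; [apply: SM|move=> Jbr; apply: nb].
- by move=> x [Sx Jxr]; split=> //; rewrite mulrCA; apply: JM.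
Qed.

(** If [x ^+ k * r ^+ n] is in [I], so is [(x * r) ^+ (k + n)]. Conversely, [(x * r) ^+ k] in [I]
    puts [x ^+ k] in the colon of [r ^+ k], hence in the stable colon. *)
Lemma radical_colon (R : comPzRingType) (S I : set R) r :
  subring_of S -> acc_ideals S -> ideal_of S I -> S r ->
  exists2 n, (0 < n)%N &
    radical S (colon S I (r ^+ n)) = colon S (radical S I) r.
Proof.
move=> sS acc idI Sr; have [S1 SB SM] := sS; have [_ IM] := idI.
have inc n : colon S I (r ^+ n) `<=` colon S I (r ^+ n.+1).
  by move=> x [Sx Ix]; split=> //; rewrite exprS mulrCA; apply: IM.
have [||n nP] := acc (fun n => colon S I (r ^+ n)) => //.
  by move=> n; apply: ideal_colon.
(* The exponent [n.+1] is positive even if the chain is stable from 0 on. Passing through the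
   exponent [n + k] avoids comparing [k] with [n]. *)
have incn k : colon S I (r ^+ k) `<=` colon S I (r ^+ n.+1).
  rewrite (nP n.+1 (leqnSn n)) -(nP (n + k)%N (leq_addr k n)).
  elim: n {nP} => // n IH; exact: subset_trans IH (inc _).
exists n.+1 => //; apply/seteqP; split=> x [Sx].
  case=> k [k0 [Sxk Ixk]]; split=> //; split; first exact: SM.
  exists (k + n.+1)%N; rewrite addn_gt0 k0; split=> //.
  have -> : (x * r) ^+ (k + n.+1) =
      (x ^+ n.+1 * r ^+ k) * (x ^+ k * r ^+ n.+1).
    by rewrite [RHS]mulrACA -!exprD [(n.+1 + k)%N]addnC exprMn.
  by apply: (IM) => //; apply: (SM); apply: subringX.
case=> _ [k [k0]]; rewrite exprMn => Ixr; split=> //; exists k; split=> //.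
by apply: (incn k); split=> //; apply: subringX.
Qed.

(** * Residuals of the component of [N] as colon ideals *)

Theorem theorem3p14 (G : groupType)
    (abelianG : forall g h : G, (g * h = h * g)%g)
    (R : comPzRingType) (Rg : G -> set R)
    (gradedR : graded_ring Rg) (noethR : gr_noetherian Rg)
    (M : lmodType R) (Mg : G -> set M) (gradedM : graded_module Rg Mg)
    (N : set M) (gradedN : graded_submodule Mg N) (g : G)
    (absN : G2_absorbing (Rg 1%g) (Mg g) (N `&` Mg g))
    (m : M) (m_in : (Mg g `\` (N `&` Mg g)) m) :
  let Re := Rg 1%g in
  let Ng := N `&` Mg g in
  let Gr := radical Re in
  prime_ideal_of Re (Gr (residual Re Ng [set m])) \/
  exists r n, [/\ (Re `\` Gr (residual Re Ng [set m])) r, (0 < n)%N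
    & prime_ideal_of Re (Gr (residual Re Ng [set r ^+ n *: m]))].
Proof.
move=> Re Ng Gr; have [dR mulR] := gradedR.
have sRe : subring_of Re.
  split; first exact: graded_ring1.
    by case: dR => subR _ _; case: (subR 1%g).
  by move=> x y Rx Ry; rewrite /Re -[1%g]mulg1; apply: mulR.
have acc : acc_ideals Re by apply: gr_noetherian_acc.
case: m_in => mg nNm; case: absN => -[[NM N0 NB] Nmul] _ _.
have [Re1 ReB ReM] := sRe.
set I := residual Re Ng [set m].
have IE x : I x <-> Re x /\ Ng (x *: m).
  by split=> -[Rx Nx]; split=> //; [apply: Nx|move=> _ ->].
have idI : ideal_of Re I.
  split; first split.
  - by move=> x [].
  - by apply/IE; rewrite scale0r -(subrr 1); split=> //; apply: ReB.
  - move=> x y /IE[Rx Nx] /IE[Ry Ny]; apply/IE; rewrite scalerBl.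
    by split; [apply: ReB|apply: NB].
  - move=> r x Rr /IE[Rx Nx]; apply/IE; rewrite -scalerA.
    by split; [apply: ReM|apply: Nmul].
have colonE r n : Re r ->
    residual Re Ng [set r ^+ n *: m] = colon Re I (r ^+ n).
  move=> Rr; have Rrn : Re (r ^+ n) by apply: subringX.
  apply/seteqP; split=> x [Rx].
    move=> /(_ _ erefl) Nx; split=> //; apply/IE; rewrite -scalerA.
    by split=> //; apply: ReM.
  by move=> /IE[_ Nx]; split=> // _ ->; rewrite scalerA.
have idGr : ideal_of Re (Gr I) by apply: ideal_radical.
(* As [m] is outside [Ng], no power of 1 lies in [I]; the family of colons below is thus
   nonempty. *)
have D1 : (Re `\` Gr I) 1.
  split=> // -[_ [k [_]]]; rewrite expr1n => /IE[_].
  by rewrite scale1r.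
(* The family is indexed by multipliers rather than by ideals, so the maximal member comes with the
   [r] required in the conclusion. *)
have [||r Dr maxr] :=
    acc_ideals_maximal (D := Re `\` Gr I) (C := colon Re (Gr I)) acc.
- by move=> t _; apply: ideal_colon.
- by exists 1.
have [Rr _] := Dr.
have [n n0 radE] := radical_colon sRe acc idI Rr.
right; exists r, n; split=> //; rewrite colonE // /Gr radE.
exact: maximal_colon_prime.
Qed.
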